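(* There exist an absolute constant $C$, a labeling scheme, and a deterministic distributed algorithm using its labels such that, for every $k\ge 1$ and every instance of $k$-gathering on a radio network with diameter $D$ and maximum degree $\Delta\geq 1$, the labeling scheme has length at most $C\,(1+\min(\log k,\log\Delta))$ on this instance and the algorithm accomplishes $k$-gathering in at most $D+k$ rounds.
   Context: Radio network: a finite simple undirected connected graph $G=(V,E)$. Computation proceeds in synchronous rounds. In each round every node either transmits a message to all its neighbors or listens. A node $v$ receives the message of a neighbor $w$ in a round iff $v$ listens in this round and $w$ is the only neighbor of $v$ transmitting in this round; otherwise $v$ receives nothing, and cannot tell whether any neighbor transmitted. There is no bound on message size, so several source messages may be combined in one transmission. $k$-gathering: an instance is a network with $k$ distinct nodes $s_1,\dots,s_k$ (sources), each holding a message, and a node $s$ (sink). All $k$ messages must reach $s$. Labeling scheme: assigns to each node of each instance a binary string (its label), possibly depending on the whole instance; labels need not be distinct. Its length is the maximum length of an assigned label. In a deterministic distributed algorithm all nodes run the same algorithm (the same for all instances); initially a node knows only its own label and, if it is a source, its message. Nodes know nothing else about the network. Non-spontaneous wake-up: only the sources start at round $0$; any other node joins only after receiving a message. The current round number may be attached to every message, so a node that has been woken up knows the global round number. All logarithms are to base 2. *)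

(* Defs.v *)
From HB Require Import structures.
From mathcomp Require Import all_boot all_order all_algebra.
From mathcomp Require Import reals exp.

Set Implicit Arguments.
Unset Strict Implicit.
Unset Printing Implicit Defensive.

Import Order.TTheory GRing.Theory Num.Theory.

Record network := Network {
  node :> finType;
  adj : rel node;
  adj_sym : symmetric adj;
  adj_irrefl : irreflexive adj;
  adj_connected : forall u v : node, connect adj u v
}.

Section Graph.
Variable G : network.

Definition walk (n : nat) (u v : G) : bool :=
  [exists p : n.-tuple G, path (@adj G) u p && (last u p == v)].

Lemma walk_exists (u v : G) : exists n, walk n u v.
Proof.
have /connectP[p up ->] := adj_connected u v.
by exists (size p); apply/existsP; exists (in_tuple p); rewrite /= up eqxx.
Qed.

Definition distance (u v : G) : nat := ex_minn (walk_exists u v).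

Definition diameter : nat := \max_(u : G) \max_(v : G) distance u v.

Definition max_degree : nat := \max_(v : G) #|[set w | adj v w]|.

End Graph.

(* The sink is allowed to be one of the sources. The contents of the source
   messages are not part of the instance: they are a separate input of an
   execution, so that labels cannot depend on them. *)
Record instance (k : nat) := Instance {
  net :> network;
  source : 'I_k -> net;
  source_inj : injective source;
  sink : net
}.

Definition message := seq bool.
Definition label := seq bool.

Definition labeling_scheme := forall (k : nat) (I : instance k), I -> label.

Definition scheme_length (L : labeling_scheme) (k : nat) (I : instance k) : nat :=
  \max_(v : I) size (L k I v).

(* What is sent in one transmission: any number of source messages, together
   with arbitrary further information (for instance the round number). *)
Record packet := Packet {
  payload : seq message;
  control : seq bool
}.

(* The list of what a node heard, in chronological order, with one entry per
   round since the node joined: [Some p] if it received [p], and [None] if it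
   received nothing (in particular if it transmitted itself). The first entry
   is round 0 for a source, and the round of its first reception for any other
   node; hence a node does not get the global round number for free. *)
Definition heard := seq (option packet).

Definition known (own : option message) (h : heard) : seq message :=
  seq_of_opt own ++ flatten [seq payload p | p <- pmap id h].

(* What a node does in the next round ([None]: listen, [Some p]: transmit [p])
   depends only on its label, its message if it is a source, and what it has
   heard. The second field says that source messages cannot be made up: only
   those which the node holds or has received can be put in a payload. *)
Record algorithm := Algorithm {
  action :> label -> option message -> heard -> option packet;
  action_payload : forall l own h p,
    action l own h = Some p -> {subset payload p <= known own h}
}.

Section Execution.
Variables (A : algorithm) (k : nat) (I : instance k).
Variables (lab : I -> label) (mu : 'I_k -> message).

Definition own_message (v : I) : option message :=
  omap mu [pick i | source I i == v].

(* In these three definitions [H v] is what [v] has heard before the current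
   round; it is empty for a non-source that has not been woken up yet. *)
Definition awake (H : I -> heard) (v : I) : bool :=
  isSome (own_message v) || (0 < size (H v)).

Definition transmission (H : I -> heard) (v : I) : option packet :=
  if awake H v then A (lab v) (own_message v) (H v) else None.

Definition reception (H : I -> heard) (v : I) : option packet :=
  if transmission H v is Some _ then None else
  if [seq w <- enum I | adj v w && isSome (transmission H w)] is [:: w]
  then transmission H w else None.

(* [history t v] is what [v] has heard in the first [t] rounds 0, ..., t-1. *)
Fixpoint history (t : nat) : I -> heard :=
  if t is t'.+1 then fun v =>
    let H := history t' in
    if awake H v || isSome (reception H v)
    then rcons (H v) (reception H v) else [::]
  else fun=> [::].

Definition gathered (t : nat) : Prop :=
  forall i : 'I_k, mu i \in known (own_message (sink I)) (history t (sink I)).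

End Execution.

Definition log2 (R : realType) (x : R) : R := (ln x / ln 2)%R.

(* Main.v *)
Require Import Defs.
From HB Require Import structures.
From mathcomp Require Import all_boot all_order all_algebra.
From mathcomp Require Import boolp reals exp.
From mathcomp Require Import zify.

Set Implicit Arguments.
Unset Strict Implicit.
Unset Printing Implicit Defensive.

Import Order.TTheory GRing.Theory Num.Theory.

(** Messages descend one BFS level at a time along a forest rooted at the sink.
Time is cut into D phases. In phase y only the levels congruent to D - y modulo 3
transmit, so levels do not interfere, and a node moves in the phase following the
last arrival from its children. Hence a source that nobody wakes up moves in one
of the phases 0, 1, 2, at a time bounded in terms of min(k, Delta) only, which its
label can therefore hold. Within a level and a phase, a minimal cover of the
senders in the next level is served through private neighbours, one slot after
another; each slot beyond the first merges at least one message stream into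
another, so all the additional slots of all phases number at most k, and the last
phase ends by round D + k.

Labels cannot hold absolute times. Instead, a node counts its receptions and the
rounds since the last one; the pair of counters never repeats, and its value at
the time of transmission is O(min(k, Delta)), hence takes O(1 + log min(k, Delta))
bits. *)

(** * Distances *)

Section Distance.
Variable G : network.
Implicit Types u v w : G.

Lemma walkS n u v : walk n.+1 u v = [exists w, adj u w && walk n w v].
Proof.
apply/existsP/existsP => [[p]|[w /andP[uw /existsP[p pP]]]].
  case/tupleP: p => w p /= /andP[/andP[uw pw] lp].
  by exists w; rewrite uw; apply/existsP; exists p; rewrite pw.
by exists (cons_tuple w p); rewrite /= uw.
Qed.

Lemma walk0 u v : walk 0 u v = (u == v).
Proof.
apply/existsP/idP => [[p]|uv]; first by rewrite (tuple0 p) /= .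
by exists [tuple].
Qed.

Lemma distance_walk u v : walk (distance u v) u v.
Proof. by rewrite /distance; case: ex_minnP. Qed.

Lemma distance_min n u v : walk n u v -> distance u v <= n.
Proof. by rewrite /distance; case: ex_minnP => d _; apply. Qed.

Lemma distance_eq0 u v : (distance u v == 0) = (u == v).
Proof.
apply/eqP/idP => [d0|]; first by rewrite -walk0 -d0 distance_walk.
by rewrite -walk0 => /distance_min; case: distance.
Qed.

Lemma distance_adj u v w : adj u w -> distance u v <= (distance w v).+1.
Proof.
move=> uw; apply: distance_min; rewrite walkS; apply/existsP; exists w.
by rewrite uw distance_walk.
Qed.

Lemma distance_pred u v : 0 < distance u v ->
  exists2 w, adj u w & (distance w v).+1 = distance u v.
Proof.
move=> d_gt0; have := distance_walk u v.
case dE: (distance u v) d_gt0 => [//|d] _; rewrite walkS.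
case/existsP=> w /andP[uw /distance_min wd]; exists w => //.
by have := distance_adj v uw; rewrite dE; lia.
Qed.

Lemma distance_diameter u v : distance u v <= diameter G.
Proof.
rewrite /diameter (leq_trans _ (leq_bigmax u))//.
exact: (leq_bigmax (F := fun v => distance u v)).
Qed.

Lemma degree_max u (A : {set G}) :
  {in A, forall w, adj u w} -> #|A| <= max_degree G.
Proof.
move=> Au; rewrite (leq_trans _ (leq_bigmax u))// subset_leq_card//.
by apply/subsetP => w /Au uw; rewrite inE.
Qed.

End Distance.

(** * Collision-free slots between two levels *)

(* Minimality of the cover [C] gives each of its elements a private neighbour in
   [A]; all private neighbours share slot 0, and the rest of [A] is then scheduled
   towards [C]. *)
Lemma slots (T : finType) (e : rel T) (A : {set T}) :
  {in A, forall a, exists b, e a b} ->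
  exists fr : (T -> T) * (T -> nat),
    [/\ {in A, forall a, e a (fr.1 a)},
        {in A &, forall a b, a != b -> fr.2 a = fr.2 b -> ~~ e b (fr.1 a)},
        {in A, forall a, fr.2 a < #|[set b in A | e b (fr.1 a)]|} &
        {in A, forall a, fr.2 a + #|fr.1 @: A| <= #|A|}].
Proof.
(* Confining the values of [fr.1] to [B] strengthens the induction: once the cover [C] is chosen,
   the remaining elements of [A] must be sent into [C] itself. *)
suff: forall (B : {set T}), {in A, forall a, exists2 b, b \in B & e a b} ->
  exists fr : (T -> T) * (T -> nat),
    [/\ {in A, forall a, fr.1 a \in B /\ e a (fr.1 a)},
        {in A &, forall a b, a != b -> fr.2 a = fr.2 b -> ~~ e b (fr.1 a)},
        {in A, forall a, fr.2 a < #|[set b in A | e b (fr.1 a)]|} &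
        {in A, forall a, fr.2 a + #|fr.1 @: A| <= #|A|}].
  move=> H eA; have [|fr [h1 h2 h3 h4]] := H setT.
    by move=> a /eA[b ab]; exists b.
  by exists fr; split=> // a /h1[].
have [n] := ubnP #|A|; elim: n A => // n IH A ltA B eA.
have [->|A0] := eqVneq A set0.
  by exists (id, fun=> 0); split=> [a|a b|a|a]; rewrite inE.
pose covers (C : {set T}) := (C \subset B) && [forall a in A, exists b in C, e a b].
have covB : covers B.
  rewrite /covers subxx; apply/forall_inP => a /eA[b bB ab].
  by apply/exists_inP; exists b.
have [C /minsetP[/andP[sCB /forall_inP covC] minC] _] := minset_exists covB.
have priv c : exists p, c \in C ->
    p \in A /\ forall c', c' \in C -> e p c' = (c' == c).
  have [cC|] := boolP (c \in C); last by exists c.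
  have : ~~ covers (C :\ c).
    apply/negP => /minC/(_ (subsetDl _ _)) /setP/(_ c).
    by rewrite !inE eqxx cC.
  rewrite /covers (subset_trans (subsetDl _ _) sCB)/= negb_forall_in.
  case/exists_inP => p pA /exists_inPn np; exists p => _; split=> // c' c'C.
  have np' : forall x, x \in C -> x != c -> ~~ e p x.
    by move=> x xC xc; apply: np; rewrite !inE xc.
  have [->|c'c] := eqVneq; last by apply/negbTE/np'.
  have /exists_inP[x xC px] := covC p pA.
  have [<-//|xc] := eqVneq x c; by have := np' x xC xc; rewrite px.
have [p pP] := choice priv.
have pinj : {in C &, injective p}.
  move=> c c' cC c'C pc; have [_ h] := pP _ cC; have [_ h'] := pP _ c'C.
  by apply/eqP; rewrite -(h' c cC) -pc h.
pose P := p @: C; pose A' := A :\: P.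
have sPA : P \subset A by apply/subsetP => _ /imsetP[c /pP[pA _] ->].
have cardP : #|P| = #|C| by rewrite card_in_imset.
have C_gt0 : 0 < #|C|.
  have /set0Pn[a /covC/exists_inP[c cC _]] := A0.
  by apply/card_gt0P; exists c.
have cardA : #|A| = #|A'| + #|C|.
  by rewrite -cardP -(cardsID P A) (setIidPr sPA) addnC.
have [|a|[f r] /= [h1 h2 h3 h4]] := IH A' _ C.
- by rewrite -ltnS (leq_trans _ ltA)// ltnS cardA; lia.
- by rewrite inE => /andP[_ /covC/exists_inP[c]]; exists c.
pose q x := odflt x [pick c in C | p c == x].
have qp c : c \in C -> q (p c) = c.
  move=> cC; rewrite /q; case: pickP => [d /andP[dC /eqP pd]|/(_ c)] /=.
    exact: pinj.
  by rewrite cC eqxx.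
have A'P a : a \in A -> a \notin P -> a \in A' by rewrite inE => -> ->.
exists (fun a => if a \in P then q a else f a,
        fun a => if a \in P then 0 else (r a).+1) => /=.
have gC a : a \in A -> (if a \in P then q a else f a) \in C.
  move=> aA; case: ifPn => [/imsetP[c cC ->]|aP]; first by rewrite qp.
  by have [] := h1 a (A'P _ aA aP).
split.
- move=> a aA; split; first by rewrite (subsetP sCB) ?gC.
  case: ifPn => [/imsetP[c cC ->]|aP]; last by have [] := h1 a (A'P _ aA aP).
  by have [_ ->] := pP c cC; rewrite ?qp.
- move=> a b aA bA ab.
  case: (ifPn (a \in P)) => [/imsetP[c cC ac]|aP];
    case: (ifPn (b \in P)) => [/imsetP[d dC bd]|bP] //.
    move=> _; rewrite ac qp// bd; have [_ ->//] := pP d dC.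
    by apply: contraNneq ab => cd; rewrite ac bd cd.
  by move=> [rab]; apply: h2; rewrite ?A'P.
- move=> a aA; case: ifPn => [/imsetP[c cC ac]|aP].
    apply/card_gt0P; exists a; rewrite inE aA ac qp//.
    by have [_ ->] := pP c cC; rewrite ?eqxx.
  have aA' := A'P _ aA aP; have [fC _] := h1 a aA'.
  (* The private neighbour [p (f a)] of [f a] lies outside [A']: it is one neighbour more than the
     induction hypothesis counts, and pays for shifting slots by one. *)
  apply: leq_trans (_ : #|p (f a) |: [set b in A' | e b (f a)]| <= _).
    rewrite cardsU1 !inE imset_f//= add1n ltnS; by apply: h3.
  apply/subset_leq_card/subsetP => b; rewrite !inE.
  case/orP=> [/eqP->|/andP[/andP[_ ->]->//]].
  by have [-> ->] := pP _ fC; rewrite ?eqxx.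
(* All values lie in [C], so at most [#|C|] are used. The shift by one is paid for by the
   nonemptiness of [f @: A']. *)
move=> a aA; apply: (@leq_trans ((if a \in P then 0 else (r a).+1) + #|C|)).
  rewrite leq_add2l; apply/subset_leq_card/subsetP => _ /imsetP[x xA ->].
  exact: gC.
rewrite cardA; case: ifPn => [_|aP]; first by rewrite add0n leq_addl.
have aA' := A'P _ aA aP; have := h4 a aA'.
have : 0 < #|f @: A'| by apply/card_gt0P; exists (f a); apply: imset_f.
by lia.
Qed.

(** * The gathering forest *)

Section Forest.
Variables (G : network) (s : G).

Definition down (a b : G) : bool :=
  adj a b && ((distance b s).+1 == distance a s).

Definition phase_class (A : {set G}) (p : G -> nat) (x y : nat) : {set G} :=
  [set a in A | (distance a s == x) && (p a == y)].

(** By [phase_mod3], distinct levels active in one phase are at least three apart. [slot_lt] serves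
    the label length, [slot_card] the running time. The conditions on a node's own parent and slot
    exempt the sink, the only node at distance 0. *)
Record forest (S : {set G}) := Forest {
  tree : {set G};
  parent : G -> G;
  phase : G -> nat;
  slot : G -> nat;
  source_tree : S \subset tree;
  phase_le : {in tree, forall v, distance v s + phase v <= diameter G};
  phase_mod3 : {in tree, forall v, distance v s + phase v = diameter G %[mod 3]};
  treeP : {in tree, forall v, v \in S /\ phase v < 3 \/ exists2 b, b \in tree &
    [/\ 0 < distance b s, parent b = v & phase v = (phase b).+1]};
  parent_tree : {in tree, forall v, 0 < distance v s -> parent v \in tree};
  parent_down : {in tree, forall v, 0 < distance v s -> down v (parent v)};
  parent_phase : {in tree, forall v, 0 < distance v s ->
    phase v < phase (parent v)};
  slot_free : {in tree &, forall v w, 0 < distance v s -> v != w ->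
    distance v s = distance w s -> phase v = phase w -> slot v = slot w ->
    ~~ down w (parent v)};
  slot_lt : {in tree, forall v, 0 < distance v s -> slot v <
    #|[set w in phase_class tree phase (distance v s) (phase v) |
        down w (parent v)]|};
  slot_card : {in tree, forall v, 0 < distance v s ->
    slot v + #|parent @: phase_class tree phase (distance v s) (phase v)|
      <= #|phase_class tree phase (distance v s) (phase v)|}
}.

Lemma forest_exists (S : {set G}) : inhabited (forest S).
Proof.
pose lv v := distance v s; pose D := diameter G.
pose spec (A : {set G}) (fr : (G -> G) * (G -> nat)) :=
  [/\ {in A, forall a, down a (fr.1 a)},
      {in A &, forall a b, a != b -> fr.2 a = fr.2 b -> ~~ down b (fr.1 a)},
      {in A, forall a, fr.2 a < #|[set b in A | down b (fr.1 a)]|} &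
      {in A, forall a, fr.2 a + #|fr.1 @: A| <= #|A|}].
(* The schedule is a function of the set of senders alone, so all members of a phase class use the
   same one. The default value covers sets containing the sink. *)
have /choice[sch schP] (A : {set G}) :
    exists fr, {in A, forall a, 0 < lv a} -> spec A fr.
  have [H|H] := pselect {in A, forall a, 0 < lv a}; last by exists (id, fun=> 0).
  have [|fr frP] := @slots G down A; last by exists fr.
  move=> a /H a_gt0; have [b ab lb] := distance_pred a_gt0.
  by exists b; rewrite /down ab lb eqxx.
pose hit A p v y := let K := phase_class A p (lv v).+1 y in v \in (sch K).1 @: K.
(* A source may use the first phase of its residue class; a node with children moves one phase after
   the last of them. Both values are congruent to [D - lv v] modulo 3. *)
pose step (Ap : {set G} * (G -> nat)) :=
  ([set v | (v \in S) || [exists y : 'I_D, hit Ap.1 Ap.2 v y]],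
   fun v => maxn (if v \in S then (D - lv v) %% 3 else 0)
                 (\max_(y < D | hit Ap.1 Ap.2 v y) y.+1)).
(* [step] at a level only reads the next higher level, so its iterates stabilize. *)
have [it itS] : exists it, forall n, it n.+1 = step (it n).
  by exists (fun n => iter n step (set0, fun=> 0)).
have stable n v : D < lv v + n ->
    (v \in (it n.+1).1) = (v \in (it n).1) /\ (it n.+1).2 v = (it n).2 v.
  elim: n v => [|n IH] v lvn.
    by have := distance_diameter v s; rewrite -/(lv v) -/D; lia.
  have hitE y : hit (it n.+1).1 (it n.+1).2 v y = hit (it n).1 (it n).2 v y.
    rewrite /hit; suff -> : phase_class (it n.+1).1 (it n.+1).2 (lv v).+1 y =
      phase_class (it n).1 (it n).2 (lv v).+1 y by [].
    apply/setP => a; rewrite !inE.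
    have [la|] := eqVneq (distance a s) (lv v).+1; last by rewrite !andbF.
    by have [|-> ->] := IH a; rewrite // /lv la; lia.
  split; rewrite (itS n.+1) [in RHS]itS /=.
    by rewrite !inE; congr (_ || _); apply: eq_existsb => y; apply: hitE.
  by congr maxn; apply: eq_bigl => y; apply: hitE.
have [A [p [AE pE]]] : exists (A : {set G}) (p : G -> nat),
    (forall v, (v \in A) = (v \in S) || [exists y : 'I_D, hit A p v y]) /\
    (forall v, p v = maxn (if v \in S then (D - lv v) %% 3 else 0)
                          (\max_(y < D | hit A p v y) y.+1)).
  (* [D.+1] iterations reach the fixed point on every level, including level 0 of the sink. *)
  exists (it D.+1).1, (it D.+1).2.
  split=> v; have [|hA hp] := stable D.+1 v; try lia.
    by rewrite -hA itS inE.
  by rewrite -hp itS.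
clear it itS stable step.
pose K v := phase_class A p (lv v) (p v).
have KP v : 0 < lv v -> spec (K v) (sch (K v)).
  by move=> lv_gt0; apply: schP => a; rewrite inE /lv => /and3P[_ /eqP-> _].
have KE v w : lv v = lv w -> p v = p w -> K v = K w by rewrite /K => -> ->.
have memK v w : (w \in K v) = [&& w \in A, lv w == lv v & p w == p v].
  by rewrite inE.
pose f v := (sch (K v)).1 v.
have hitP v y : reflect (exists2 b, b \in A & [/\ lv b = (lv v).+1, f b = v & p b = y])
                        (hit A p v y).
  rewrite /hit; apply: (iffP imsetP) => [[b]|[b bA [lb fb pb]]].
    rewrite inE => /and3P[bA /eqP lb /eqP pb] vE; exists b => //; split=> //.
    by rewrite /f /K pb [lv b]lb -vE.
  exists b; first by rewrite inE bA pb -/(lv b) lb !eqxx.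
  by rewrite -[LHS]fb /f /K lb pb.
have phP n v : D <= lv v + n -> v \in A ->
   [/\ lv v + p v <= D, lv v + p v = D %[mod 3] &
       v \in S /\ p v < 3 \/ exists2 b, b \in A &
         [/\ 0 < lv b, f b = v & p v = (p b).+1]].
  elim/ltn_ind: n v => n IH v lvn vA.
  have lvD : lv v <= D by apply: distance_diameter.
  (* The maximum defining [p v] is attained either by the residue of a source, which is below 3, or
     by the latest child. *)
  have [[vS ->]|[y /hitP[b bA [lb fb pb]] ->]] :
      (v \in S /\ p v = (D - lv v) %% 3) \/ exists2 y : 'I_D, hit A p v y & p v = y.+1.
    rewrite pE; have [[y hy]|no_hit] := pselect (exists y : 'I_D, hit A p v y).
      have [z hz zE] := @eq_bigmax_cond _ [pred y : 'I_D | hit A p v y]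
        (fun y => y.+1) (introT card_gt0P (ex_intro _ y hy)).
      case: (boolP (v \in S)) => vS; last by right; exists z; rewrite ?max0n.
      by rewrite zE; case: leqP => _; [right; exists z | left].
    left; rewrite big_pred0 ?maxn0 => [|y]; last first.
      by apply/negP => hy; apply: no_hit; exists y.
    move: vA; rewrite AE => /orP[vS|/existsP[y hy]]; first by rewrite vS.
    by case: no_hit; exists y.
  - have := leq_mod (D - lv v) 3; have := ltn_pmod (D - lv v) (isT : 0 < 3).
    split; [lia| |by left].
    by rewrite modnDmr subnKC.
  - have lbD : lv b <= D by apply: distance_diameter.
    have [|||h1 h2 _] := IH n.-1 _ b; rewrite ?lb //; try lia.
    split; [lia| |by right; exists b; rewrite ?lb ?pb].
    by rewrite -h2 -pb lb addnS addSn.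
have fA v : v \in A -> 0 < lv v -> [/\ f v \in A, down v (f v) & p v < p (f v)].
  move=> vA lv0; have [/(_ v) dv _ _ _] := KP v lv0.
  have vK : v \in K v by rewrite memK vA !eqxx.
  have dfv := dv vK; have [le_D _ _] := phP D v (leq_addl _ _) vA.
  (* Since [v] is not the sink, its phase is below [D]; so the range [y < D] in [step] misses no
     child. *)
  have ltD : p v < D by lia.
  have hfv : hit A p (f v) (Ordinal ltD).
    by apply/hitP; exists v => //; case/andP: dfv => _ /eqP.
  split=> //; first by rewrite AE; apply/orP; right; apply/existsP; exists (Ordinal ltD).
  rewrite (pE (f v)) leq_max; apply/orP; right.
  exact: (bigop.bigmax_sup (Ordinal ltD)).
have vK v : v \in A -> v \in K v by rewrite memK !eqxx => ->.
have fK v : f @: K v = (sch (K v)).1 @: K v.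
  apply: eq_in_imset => w; rewrite memK => /and3P[_ /eqP lw /eqP pw].
  by rewrite /f (KE w v).
constructor; apply: (@Forest S A f p (fun v => (sch (K v)).2 v)).
- by apply/subsetP => v vS; rewrite AE vS.
- by move=> v vA; have [] := phP D v (leq_addl _ _) vA.
- by move=> v vA; have [] := phP D v (leq_addl _ _) vA.
- by move=> v vA; have [] := phP D v (leq_addl _ _) vA.
- by move=> v vA v0; have [] := fA v vA v0.
- by move=> v vA v0; have [] := fA v vA v0.
- by move=> v vA v0; have [] := fA v vA v0.
- move=> v w vA wA v0 vw lvw pvw; have [_ h _ _] := KP v v0.
  by rewrite -(KE v w) //; apply: h => //; rewrite ?vK// (KE v w)// vK.
- by move=> v vA v0; have [_ _ h _] := KP v v0; apply: h; apply: vK.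
- move=> v vA v0; have [_ _ _ h] := KP v v0.
  by rewrite -/(K v) fK; apply: h; apply: vK.
Qed.

End Forest.

(** * The schedule *)

Section Schedule.
Variables (G : network) (s : G) (S : {set G}) (F : forest s S).

Definition senders : {set G} := [set v in tree F | 0 < distance v s].

(** A phase without senders still lasts one round. These first rounds make up the [D] of the bound
    [D + k], the later slots the [k]. *)
Definition phase_length (y : nat) : nat :=
  (\max_(v in senders | phase F v == y) slot F v).+1.

Definition phase_start (y : nat) : nat := \sum_(z < y) phase_length z.

Definition send_time (v : G) : nat := phase_start (phase F v) + slot F v.

Lemma phase_startS y : phase_start y.+1 = phase_start y + phase_length y.
Proof. by rewrite /phase_start big_ord_recr. Qed.

Lemma phase_start_mono y z : y <= z -> phase_start y <= phase_start z.
Proof.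
move/subnKC <-; elim: (z - y) => [|n IH]; first by rewrite addn0.
by rewrite addnS phase_startS (leq_trans IH)// leq_addr.
Qed.

Lemma send_time_lt v : v \in senders -> send_time v < phase_start (phase F v).+1.
Proof.
move=> vX; rewrite phase_startS ltn_add2l ltnS.
by apply: (bigop.bigmax_sup v); rewrite ?vX/=.
Qed.

Lemma send_time_inj v w : v \in senders -> w \in senders ->
  send_time v = send_time w -> phase F v = phase F w /\ slot F v = slot F w.
Proof.
move=> vX wX vw; suff pE : phase F v = phase F w.
  by split=> //; move: vw; rewrite /send_time pE => /addnI.
have lt_vX := send_time_lt vX; have lt_wX := send_time_lt wX.
have le_v : phase_start (phase F v) <= send_time v := leq_addr _ _.
have le_w : phase_start (phase F w) <= send_time w := leq_addr _ _.
by case: (ltngtP (phase F v) (phase F w)) => // /phase_start_mono; lia.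
Qed.

Lemma sender_tree v : v \in senders -> v \in tree F /\ 0 < distance v s.
Proof. by rewrite inE => /andP. Qed.

(** Equal times force equal phases, hence levels congruent modulo 3. A neighbour of [parent F v] is
    at most two levels away from [v], so both senders are on one level, where [slot_free]
    applies. *)
Lemma no_collision v w : v \in senders -> w \in senders ->
  send_time w = send_time v -> adj (parent F v) w -> w = v.
Proof.
move=> vX wX wv fvw; have [pE sE] := send_time_inj wX vX wv.
have [vT v0] := sender_tree vX; have [wT _] := sender_tree wX.
have /andP[_ /eqP dv] := parent_down vT v0.
have wfv : adj w (parent F v) by rewrite adj_sym.
have lw : distance v s = distance w s.
  have := phase_mod3 vT; have := phase_mod3 wT; rewrite pE.
  have := distance_adj s fvw; have := distance_adj s wfv; lia.
apply/eqP; apply: contraT => wv'.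
have := slot_free vT wT v0; rewrite eq_sym wv' /down wfv dv lw eqxx /=.
by move=> /(_ isT (erefl _)); apply; rewrite ?pE ?sE.
Qed.

Lemma send_time_parent v : v \in senders -> send_time v < send_time (parent F v).
Proof.
move=> vX; have [vT v0] := sender_tree vX.
apply: (leq_trans (send_time_lt vX)).
exact: leq_trans (phase_start_mono (parent_phase vT v0)) (leq_addr _ _).
Qed.

Lemma phase_lt_diameter v : v \in senders -> phase F v < diameter G.
Proof. by case/sender_tree => /phase_le; lia. Qed.

Lemma send_time_end v : v \in senders -> send_time v < phase_start (diameter G).
Proof.
move=> vX; apply: (leq_trans (send_time_lt vX)).
by rewrite phase_start_mono // phase_lt_diameter.
Qed.

(** The level attaining the largest slot satisfies the inequality by [slot_card]; each other level
    active in the phase has at most as many parents as senders. *)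
Lemma card_phase y (X := [set v in senders | phase F v == y]) :
  (phase_length y).-1 + #|parent F @: X| <= #|X|.
Proof.
rewrite (_ : (phase_length y).-1 = \max_(v in X) slot F v); last first.
  by apply: eq_bigl => v; rewrite !inE.
have [X0|X_gt0] := posnP #|X|.
  by rewrite (cards0_eq X0) big_set0 imset0 cards0.
have [v vX ->] := eq_bigmax_cond (slot F) X_gt0.
move: (vX); rewrite inE => /andP[/sender_tree[vT v0] /eqP vy].
set K := phase_class s (tree F) (phase F) (distance v s) (phase F v).
have sKX : K \subset X.
  apply/subsetP => w; rewrite !inE => /and3P[-> /eqP-> /eqP->].
  by rewrite v0 vy eqxx.
have := slot_card vT v0; rewrite -/K => slotK.
have XE : X = K :|: (X :\: K) by rewrite -{1}(setID X K) (setIidPr sKX).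
have leX : #|parent F @: X| <= #|parent F @: K| + #|X :\: K|.
  rewrite {1}XE imsetU (leq_trans (leq_card_setU _ _))//.
  by rewrite leq_add2l leq_imset_card.
have := subset_leq_card sKX; move: leX; rewrite cardsD (setIidPr sKX); lia.
Qed.

(** Summing [card_phase] bounds the extra slots by [#|senders| - #|parent F @: senders|]. Every
    sender is a source or the parent of a sender, so this difference is at most [#|S|]. *)
Lemma sum_phase_length : phase_start (diameter G) <= diameter G + #|S|.
Proof.
pose X n := [set v in senders | phase F v < n].
pose Y n := [set v in senders | phase F v == n].
have XS n : X n.+1 = X n :|: Y n.
  by apply/setP => v; rewrite !inE ltnS (leq_eqVlt (phase F v)) andb_orr orbC.
have le_X n : phase_start n + #|parent F @: X n| <= n + #|X n|.
  elim: n => [|n IH].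
    by rewrite /phase_start big_ord0 !add0n leq_imset_card.
  rewrite phase_startS XS imsetU.
  have cardXY : #|X n :|: Y n| = #|X n| + #|Y n|.
    apply/eqP; rewrite (leq_card_setU _ _) -setI_eq0; apply/eqP/setP => v.
    by rewrite !inE; case: (ltngtP (phase F v) n); rewrite ?andbF.
  have leU : #|parent F @: X n :|: parent F @: Y n| <=
    #|parent F @: X n| + #|parent F @: Y n| := leq_card_setU _ _.
  have cardY : (phase_length n).-1 + #|parent F @: Y n| <= #|Y n| := card_phase n.
  by have : 0 < phase_length n by []; lia.
have XD : X (diameter G) = senders.
  by apply/setP => v; rewrite inE; case: (boolP (v \in _)) => //= /phase_lt_diameter.
have := le_X (diameter G); rewrite XD.
suff : #|senders| <= #|parent F @: senders| + #|S| by lia.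
apply: leq_trans (leq_card_setU _ _); apply/subset_leq_card/subsetP => v.
case/sender_tree => /treeP[[vS _]|[b bT [b0 <- _]]] _; rewrite inE.
  by rewrite vS orbT.
by rewrite imset_f // inE bT.
Qed.

(** A tree node is a source or the parent of a tree node one level farther out. Induction from the
    farthest level inwards thus charges each level to the sources at that level or beyond. *)
Lemma card_level x : #|[set v in tree F | distance v s == x]| <= #|S|.
Proof.
suff H n : diameter G < x + n -> #|[set v in tree F | distance v s == x]| <=
    #|[set v in S | x <= distance v s]|.
  apply: leq_trans (H (diameter G).+1 _) _; first by lia.
  by apply/subset_leq_card/subsetP => v; rewrite inE => /andP[].
elim: n x => [|n IH] x ltx.
  rewrite (_ : [set v in tree F | _] = set0) ?cards0 //.
  apply/setP => v; rewrite !inE; have := distance_diameter v s.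
  by case: eqP => //; [lia | rewrite andbF].
have ltSx : diameter G < x.+1 + n by lia.
rewrite (_ : [set v in S | _] = [set v in S | distance v s == x] :|:
                                [set v in S | x < distance v s]); last first.
  by apply/setP => v; rewrite !inE leq_eqVlt eq_sym andb_orr.
rewrite cardsU (_ : _ :&: _ = set0) ?cards0 ?subn0; last first.
  by apply/setP => v; rewrite !inE; case: ltngtP; rewrite ?andbF.
apply: leq_trans (leq_add (leqnn _) (IH _ ltSx)).
apply: leq_trans (leq_add (leqnn _) (leq_imset_card (parent F) _)).
apply: leq_trans (leq_card_setU _ _); apply/subset_leq_card/subsetP => v.
rewrite !inE => /andP[/treeP[[vS _]|[b bT [b0 fb _]]] vx].
  by rewrite vS vx.
apply/orP; right; apply/imsetP; exists b => //; rewrite inE bT /=.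
by have /andP[_ /eqP <-] := parent_down bT b0; rewrite fb eqSS.
Qed.

Lemma card_nbrs v : #|[set w in senders | adj v w]| <= 3 * #|S|.
Proof.
pose L x := [set w in tree F | distance w s == x].
apply: (@leq_trans #|L (distance v s).-1 :|: L (distance v s) :|: L (distance v s).+1|).
  apply/subset_leq_card/subsetP => w; rewrite !inE => /andP[/andP[-> _] vw] /=.
  have := distance_adj s vw; have := distance_adj s (_ : adj w v).
  by rewrite adj_sym => /(_ vw); lia.
apply: leq_trans (leq_card_setU _ _) _.
apply: leq_trans (leq_add (leq_card_setU _ _) (leqnn _)) _.
by rewrite !mulSn addn0 addnA !leq_add // card_level.
Qed.

Lemma phase_length_le y : 0 < #|S| -> 0 < max_degree G ->
  phase_length y <= minn #|S| (max_degree G).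
Proof.
(* Positivity of the minimum settles empty phases, of length 1; written as a successor, it reduces
   the goal to a bound on single slots. *)
move=> S0 G0; have: 0 < minn #|S| (max_degree G) by rewrite leq_min S0.
case ME: (minn _ _) => [//|M] _; rewrite ltnS.
apply/bigop.bigmax_leqP => v /andP[/sender_tree[vT v0] _]; rewrite -ltnS -ME leq_min.
apply/andP; split; apply: (leq_trans (slot_lt vT v0)).
  apply: leq_trans (card_level (distance v s)); apply/subset_leq_card/subsetP => w.
  by rewrite !inE => /andP[/and3P[-> ->]].
apply: (degree_max (u := parent F v)) => w; rewrite inE adj_sym.
by case/andP => _ /andP[].
Qed.

End Schedule.

(** * Executing a schedule by counting receptions *)

Fixpoint bits (l n : nat) : seq bool :=
  if l is l'.+1 then odd n :: bits l' n./2 else [::].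

Definition unbits (s : seq bool) : nat := foldr (fun (b : bool) n => b + n.*2) 0 s.

Lemma size_bits l n : size (bits l n) = l.
Proof. by elim: l n => //= l IH n; rewrite IH. Qed.

Lemma bitsK l n : n < 2 ^ l -> unbits (bits l n) = n.
Proof.
elim: l n => [|l IH] n /=; first by rewrite expn0 ltnS leqn0 => /eqP.
rewrite expnS mul2n => ltn; rewrite IH ?odd_double_half //.
by rewrite ltn_half_double.
Qed.

Definition receptions (h : heard) : nat := count isSome h.

(** If nothing was received, [find] returns the length of [h], which for a source is the number of
    rounds elapsed since round 0. *)
Definition silence (h : heard) : nat := find isSome (rev h).

(* A label consists of two numbers of the same width, the count of receptions and
   the length of the silence after the last of them at which the node transmits;
   nodes with the empty label never transmit. *)
Definition count_action (l : label) (own : option message) (h : heard) :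
    option packet :=
  let m := (size l)./2 in
  if [&& l != [::], receptions h == unbits (take m l) &
         silence h == unbits (drop m l)]
  then Some (Packet (known own h) [::]) else None.

Lemma count_action_payload l own h p :
  count_action l own h = Some p -> {subset payload p <= known own h}.
Proof. by rewrite /count_action; case: ifP => // _ [<-]. Qed.

Definition count_algorithm : algorithm := Algorithm count_action_payload.

Section CountSchedule.
Variables (G : network) (X : {set G}) (time : G -> nat).

(** [sends], [receives] and the two counters describe the ideal run, where each node of [X]
    transmits exactly at its [time]. The execution is later shown to agree with it. *)
Definition sends (t : nat) (v : G) : bool := (v \in X) && (time v == t).

Definition receives (t : nat) (v : G) : bool :=
  ~~ sends t v && (size [seq w <- enum G | adj v w && sends t w] == 1).

Fixpoint nreceived (v : G) (t : nat) : nat :=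
  if t is t'.+1 then nreceived v t' + receives t' v else 0.

Fixpoint nsilent (v : G) (t : nat) : nat :=
  if t is t'.+1 then if receives t' v then 0 else (nsilent v t').+1 else 0.

Lemma nreceived_mono v t n : nreceived v t <= nreceived v (t + n).
Proof.
by elim: n => [|n IH]; rewrite ?addn0// addnS (leq_trans IH)// leq_addr.
Qed.

Lemma nsilentD v t n :
  nreceived v (t + n) = nreceived v t -> nsilent v (t + n) = nsilent v t + n.
Proof.
elim: n => [|n IH]; rewrite ?addn0// addnS /= => rE.
have := nreceived_mono v t n; move: rE; case: (receives _ _) => /=; first by lia.
by rewrite addn0 addnS => /IH->.
Qed.

(** Equal reception counts mean no reception in between, and then the silence grows by one in every
    round. *)
Lemma counters_inj v t t' : nreceived v t = nreceived v t' ->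
  nsilent v t = nsilent v t' -> t = t'.
Proof.
wlog le_t : t t' / t <= t' => [H rE sE|].
  by case/orP: (leq_total t t') => /H; [apply | move=> ->].
rewrite -(subnKC le_t) => rE; rewrite nsilentD//; lia.
Qed.

Lemma nreceived_gt0 v i t : receives i v -> i < t -> 0 < nreceived v t.
Proof.
move=> ri /subnKC <-; apply: leq_trans (nreceived_mono _ _ _).
by rewrite /= ri addn1.
Qed.

Lemma nsilent_le v t : nsilent v t <= t.
Proof. by elim: t => //= t IH; case: ifP. Qed.

Lemma nsilent_lt v i t : receives i v -> i < t -> nsilent v t + i < t.
Proof.
move=> ri; elim: t => //= t IH; rewrite ltnS leq_eqVlt => /predU1P[<-|it].
  by rewrite ri.
by case: ifP => _; [rewrite add0n ltnW | rewrite addSn ltnS IH].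
Qed.

Lemma receivesP t v : receives t v -> exists2 w, adj v w & sends t w.
Proof.
case/andP=> _; case E: [seq w <- _ | _] => [//|w l] _.
have : w \in [seq w <- enum G | adj v w && sends t w] by rewrite E mem_head.
by rewrite mem_filter => /andP[/andP[vw tw] _]; exists w.
Qed.

(** Every round of reception is the [time] of some neighbouring sender, so distinct rounds come from
    distinct neighbours. *)
Lemma nreceived_le v t : nreceived v t <= #|[set w in X | adj v w]|.
Proof.
have -> : nreceived v t = size [seq i <- iota 0 t | receives i v].
  elim: t => // t IH; rewrite -[t.+1 in RHS]addn1 iotaD filter_cat size_cat -IH /=.
  by rewrite add0n; case: (receives t v).
rewrite cardE -(size_map time); apply: uniq_leq_size.
  by rewrite filter_uniq// iota_uniq.
move=> i; rewrite mem_filter => /andP[/receivesP[w vw /andP[wX /eqP <-]] _].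
by rewrite map_f// mem_enum inE wX.
Qed.

Definition count_label (l : nat) (v : G) : label :=
  if v \in X then bits l (nreceived v (time v)) ++ bits l (nsilent v (time v))
  else [::].

Lemma size_count_label l v : size (count_label l v) <= 2 * l.
Proof. by rewrite /count_label; case: ifP; rewrite // size_cat !size_bits; lia. Qed.

End CountSchedule.

(** * Agreement of the execution with the ideal run, and delivery *)

Section Execution.
Variables (k : nat) (I : instance k) (mu : 'I_k -> message).
Variables (X : {set net I}) (time : net I -> nat) (target : net I -> net I) (l : nat).
Hypothesis source_sends : forall i, source I i = sink I \/ source I i \in X.
Hypothesis woken : {in X, forall v, v \in codom (source I) \/
  exists2 w, w \in X & target w = v}.
Hypothesis adj_target : {in X, forall v, adj v (target v)}.
Hypothesis target_sends : {in X, forall v, target v = sink I \/ target v \in X}.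
Hypothesis target_later : {in X, forall v, target v \in X -> time v < time (target v)}.
Hypothesis target_free : {in X &, forall v w,
  time w = time v -> adj (target v) w -> w = v}.
Hypothesis counters_lt : {in X, forall v, nreceived X time v (time v) < 2 ^ l /\
  nsilent X time v (time v) < 2 ^ l}.
Hypothesis l_gt0 : 0 < l.

Local Notation lab := (count_label X time l).
Local Notation H t := (history count_algorithm lab mu t).
Local Notation own v := (own_message mu v).

Lemma receives_target v : v \in X -> receives X time (time v) (target v).
Proof.
move=> vX; apply/andP; split.
  by apply/negP => /andP[fX /eqP ft]; have := target_later vX fX; rewrite ft ltnn.
rewrite (_ : [seq w <- _ | _] = [:: v])//.
rewrite (@eq_filter _ _ (pred1 v)) ?filter_pred1_uniq ?enum_uniq ?mem_enum//.
move=> w /=; apply/idP/eqP => [/andP[fw /andP[wX /eqP tw]]|->].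
  exact: (target_free vX).
by rewrite adj_sym adj_target ///sends vX eqxx.
Qed.

Lemma isSome_own v : isSome (own v) = (v \in codom (source I)).
Proof.
rewrite /own_message; case: pickP => [i /eqP <-|no] /=; first by rewrite codom_f.
by apply/esym/negP => /codomP[i vE]; have := no i; rewrite /= vE eqxx.
Qed.

Lemma awake_sender v t : v \in X -> time v <= t ->
  isSome (own v) || (0 < nreceived X time v t).
Proof.
move=> vX vt; rewrite isSome_own; case: (woken vX) => [->//|[w wX wv]].
rewrite orbC; have rv := receives_target wX; rewrite wv in rv.
by rewrite (nreceived_gt0 rv)//; rewrite (leq_trans _ vt)// -wv target_later// wv.
Qed.

(** The silences need agree only for awake nodes: the history of a sleeping node is empty while its
    ideal silence grows. The reception that wakes a node resets both to 0, so the global round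
    number is never consulted. *)
Definition follows (t : nat) (v : net I) (h : heard) : Prop :=
  [/\ receptions h = nreceived X time v t,
      isSome (own v) || (0 < receptions h) -> silence h = nsilent X time v t &
      (0 < size h) ==> isSome (own v) || (0 < receptions h)].

Lemma receptions_size (h : heard) : 0 < receptions h -> 0 < size h.
Proof. by case: h. Qed.

Lemma awakeE t v : follows t v (H t v) ->
  awake mu (H t) v = isSome (own v) || (0 < nreceived X time v t).
Proof.
case=> <- _; rewrite /awake; case: (isSome _) => //= /implyP h.
by apply/idP/idP => [/h|/receptions_size].
Qed.

(** An awake node sees the ideal counters, whose pair takes its labelled value at [time v] only, by
    [counters_inj]. A sleeping node is not yet due, by [awake_sender]. *)
Lemma transmissionE t v : follows t v (H t v) ->
  isSome (transmission count_algorithm lab mu (H t) v) = sends X time t v.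
Proof.
move=> fv; have [rE sE _] := fv.
rewrite /transmission awakeE// /sends /= /count_action /count_label.
have [vX|vX] := boolP (v \in X); last by case: ifP.
have [lt_r lt_s] := counters_lt vX; rewrite size_cat !size_bits addnn doubleK.
rewrite take_size_cat ?drop_size_cat ?size_bits// !bitsK// rE.
have -> /= : bits l (nreceived X time v (time v)) ++
             bits l (nsilent X time v (time v)) != [::].
  by rewrite -size_eq0 size_cat !size_bits; lia.
case: (ifPn (isSome _ || _)) => [aw|naw]; last first.
  by apply/esym/negbTE; apply: contra naw => /eqP tv; apply: awake_sender; rewrite ?tv.
rewrite sE ?rE//; have [<-|tv] := eqVneq (time v) t; first by rewrite !eqxx.
case: eqP => //= r; case: eqP => //= q.
by case/eqP: tv; apply/esym; apply: counters_inj r q.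
Qed.

Lemma receptionE t v : (forall w, follows t w (H t w)) ->
  isSome (reception count_algorithm lab mu (H t) v) = receives X time t v.
Proof.
move=> fH; rewrite /reception /receives -(transmissionE (fH v)).
case: (transmission _ _ _ _ v) => //=.
under eq_filter => w do rewrite transmissionE//.
case E: [seq w <- _ | _] => [//|w [|//]]; rewrite /= eqxx transmissionE//.
have : w \in [seq w <- enum I | adj v w && sends X time t w] by rewrite E mem_head.
by rewrite mem_filter => /andP[/andP[_ ->]].
Qed.

Lemma follows_history t v : follows t v (H t v).
Proof.
elim: t v => [|t IH] v; first by [].
have rcvE := receptionE v IH; have [rE sE zE] := IH v.
have aw := awakeE (IH v).
have recE : receptions (rcons (H t v) (reception count_algorithm lab mu (H t) v)) =
    nreceived X time v t.+1.
  by rewrite /receptions -cats1 count_cat -/(receptions _) rE /= rcvE addn0.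
rewrite /=; case: ifPn => [|]; rewrite aw rcvE; last first.
  rewrite !negb_or => /andP[/andP[nown nr] nrcv].
  split; rewrite /= ?(negbTE nrcv) ?(negbTE nown)//.
  by move: nr; rewrite addn0; case: (nreceived _ _ _).
move=> awr; split=> //; rewrite recE ?size_rcons /= addnC.
  rewrite /silence rev_rcons /= rcvE; case: ifP => //= _.
  by rewrite -rE => /sE <-.
by move: awr; case: (isSome _) => //=; case: receives; rewrite ?orbF.
Qed.

Lemma reception_target v : v \in X ->
  reception count_algorithm lab mu (H (time v)) (target v) =
  Some (Packet (known (own v) (H (time v) v)) [::]).
Proof.
move=> vX; have fH w := follows_history (time v) w.
have := receptionE (target v) fH; rewrite receives_target//.
rewrite /reception; case: (transmission _ _ _ _ (target v)) => //.
case E: [seq w <- _ | _] => [//|w [|//]] _.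
have : w \in [seq w <- enum I | adj (target v) w &&
    isSome (transmission count_algorithm lab mu (H (time v)) w)].
  by rewrite E mem_head.
rewrite mem_filter transmissionE// => /andP[/andP[fw /andP[wX /eqP tw]] _].
have -> := target_free vX wX tw fw.
have := transmissionE (fH v); rewrite /sends vX eqxx /transmission.
by case: ifP => //= _; rewrite /count_action; case: ifP.
Qed.

Lemma known_history v t n :
  {subset known (own v) (H t v) <= known (own v) (H (t + n) v)}.
Proof.
elim: n => [|n IH] x; rewrite ?addn0// => /IH; rewrite addnS /=.
case: ifPn => [_|]; last first.
  by rewrite !negb_or -leqNgt; case: (H _ v) => // ? ? /andP[/andP[]].
by rewrite /known -cats1 pmap_cat map_cat flatten_cat !mem_cat => /orP[]->; rewrite ?orbT.
Qed.

Lemma known_target v : v \in X ->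
  {subset known (own v) (H (time v) v) <=
          known (own (target v)) (H (time v).+1 (target v))}.
Proof.
move=> vX x xv; rewrite /= reception_target//= orbT.
rewrite /known -cats1 pmap_cat map_cat flatten_cat !mem_cat /=.
by move: xv; rewrite mem_cat => ->; rewrite !orbT.
Qed.

Lemma gathered_time T : {in X, forall v, time v < T} ->
  gathered count_algorithm lab mu T.
Proof.
move=> ltT i.
(* Induction on the rounds left before [T]: each hop to [target v] strictly increases the sending
   time, until the sink is reached. *)
have deliver n v : v \in X -> T <= time v + n ->
    {subset known (own v) (H (time v) v) <= known (own (sink I)) (H T (sink I))}.
  elim: n v => [|n IH] v vX leT x xv; first by have := ltT v vX; lia.
  have xf := known_target vX xv; have vT := ltT v vX.
  case: (target_sends vX) => [<-|fX].
    by rewrite -(subnKC vT); apply: known_history.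
  have vf := target_later vX fX; apply: (IH _ fX); first by lia.
  by rewrite -(subnKC vf); apply: known_history.
have own_i : own (source I i) = Some (mu i).
  rewrite /own_message; case: pickP => [j /eqP/source_inj->//|/(_ i)].
  by rewrite eqxx.
have known_i t : mu i \in known (own (source I i)) (H t (source I i)).
  by rewrite /known own_i mem_head.
case: (source_sends i) => [<-//|sX].
by apply: (deliver T _ sX); rewrite ?leq_addl.
Qed.

End Execution.

(** * Label lengths *)

(** Receptions are bounded by the number of neighbouring senders. For the silence, a source in
    phases 0, 1, 2 sends within the first three phases; any other sender hears its last child in the
    preceding phase, so its silence fits into two phases. A phase lasts at most [M] rounds. *)
Lemma counters_bound k (I : instance k) (S : {set net I}) (F : forest (sink I) S) v
  (M := minn #|S| (max_degree I)) : 0 < #|S| -> 0 < max_degree I ->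
  v \in senders F ->
  nreceived (senders F) (send_time F) v (send_time F v) <= 3 * M /\
  nsilent (senders F) (send_time F) v (send_time F v) <= 3 * M.
Proof.
move=> S_gt0 deg_gt0 vX; split.
  have le_rec := nreceived_le (senders F) (send_time F) v (send_time F v).
  have le_S : #|[set w in senders F | adj v w]| <= 3 * #|S| by apply: card_nbrs.
  have le_deg : #|[set w in senders F | adj v w]| <= max_degree I.
    by apply: (degree_max (u := v)) => w; rewrite inE => /andP[].
  by rewrite /M; lia.
have lenM y : phase_length F y <= M by apply: phase_length_le.
have startS y : phase_start F y.+1 <= phase_start F y + M.
  by rewrite phase_startS leq_add2l.
have lt_v := send_time_lt vX; have [vT _] := sender_tree vX.
case: (treeP vT) => [[_ ph3]|[b bT [b0 bv ph_v]]].
  have le_v := nsilent_le (senders F) (send_time F) v (send_time F v).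
  have := phase_start_mono F ph3; have := startS 0; have := startS 1; have := startS 2.
  by rewrite {6}/phase_start big_ord0; lia.
have bX : b \in senders F by rewrite inE bT.
have : receives (senders F) (send_time F) (send_time F b) v.
  rewrite -bv; apply: receives_target => //.
  - by move=> w /sender_tree[wT w0]; have /andP[] := parent_down wT w0.
  - by move=> w wX _; apply: send_time_parent.
  - by move=> w x wX xX; apply: no_collision.
move/nsilent_lt => /(_ (send_time F v)).
have := send_time_parent bX; rewrite bv => lt_bv /(_ lt_bv).
have le_b : phase_start F (phase F b) <= send_time F b := leq_addr _ _.
have := startS (phase F b); have := startS (phase F b).+1.
by move: lt_v; rewrite ph_v; lia.
Qed.

(** Positivity is assumed under the existential, so that labels can be chosen for all instances, as
    a labeling scheme demands; [mu] comes after [lab], so labels ignore message contents. *)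
Lemma instance_labels k (I : instance k) :
  exists lab : net I -> label, 0 < k -> 0 < max_degree I ->
    (forall v, size (lab v) <= 6 * (trunc_log 2 (minn k (max_degree I))).+1) /\
    (forall mu, exists2 t, t <= diameter I + k & gathered count_algorithm lab mu t).
Proof.
pose S := source I @: setT.
have cardS : #|S| = k by rewrite card_imset ?cardsT ?card_ord//; apply: source_inj.
have [F] := forest_exists (sink I) S.
(* From [M < 2 ^ (trunc_log 2 M).+1], two further bits accommodate [3 * M]. The label size [2 * l]
   is then at most [6 * (trunc_log 2 M).+1], whence the constant 6. *)
set M := minn _ _; pose l := (trunc_log 2 M).+3.
exists (count_label (senders F) (send_time F) l) => k_gt0 deg_gt0; split=> [v|mu].
  by rewrite (leq_trans (size_count_label _ _ _ _))// /l; lia.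
exists (phase_start F (diameter I)); first by rewrite -[X in _ + X]cardS sum_phase_length.
have tree_senders v : v \in tree F -> v = sink I \/ v \in senders F.
  move=> vT; rewrite inE vT lt0n distance_eq0.
  by have [->|] := eqVneq v (sink I); [left | right].
have sourceP v : v \in S -> v \in codom (source I).
  by case/imsetP => i _ ->; apply: codom_f.
apply: (@gathered_time _ _ _ _ _ (parent F)).
- by move=> i; apply/tree_senders/(subsetP (source_tree F))/imset_f.
- move=> v /sender_tree[/treeP[[/sourceP ? _]|[b bT [b0 bv _]]] _]; first by left.
  by right; exists b; rewrite // inE bT.
- by move=> v /sender_tree[vT v0]; have /andP[] := parent_down vT v0.
- by move=> v /sender_tree[vT v0]; apply/tree_senders/parent_tree.
- by move=> v vX _; apply: send_time_parent.
- by move=> v w vX wX; apply: no_collision.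
- move=> v vX; have M_gt0 : 0 < M by rewrite leq_min k_gt0.
  have ltM : 3 * M < 2 ^ l.
    have ltM2 : M < 2 ^ (trunc_log 2 M).+1 := trunc_log_ltn M (isT : 1 < 2).
    by rewrite /l expnS expnS; lia.
  have [||] := counters_bound _ _ vX; rewrite ?cardS//.
  by move=> h1 h2; split; apply: leq_ltn_trans ltM.
- by [].
- by move=> v; apply: send_time_end.
Qed.

Local Open Scope ring_scope.

Lemma trunc_log_log2 (R : realType) (m n : nat) : (0 < m <= n)%N ->
  (trunc_log 2 m)%:R <= log2 (n%:R : R).
Proof.
case/andP => m_gt0 le_mn; have n_gt0 : (0 < n)%N by apply: leq_trans le_mn.
have ln2_gt0 : 0 < ln (2 : R) by apply: ln_gt0; rewrite ltr1n.
rewrite /log2 ler_pdivlMr// mulr_natl -lnXn ?ltr0n// ler_ln ?posrE ?exprn_gt0 ?ltr0n//.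
by rewrite -natrX ler_nat (leq_trans (trunc_logP _ _)).
Qed.

Theorem theorem2 (R : realType) :
  exists (C : R) (L : labeling_scheme) (A : algorithm),
    forall (k : nat) (I : instance k),
      (1 <= k)%N -> (1 <= max_degree I)%N ->
      (scheme_length L I)%:R
        <= C * (1 + Num.min (log2 k%:R) (log2 (max_degree I)%:R))
      /\ (forall mu : 'I_k -> message,
            exists2 t : nat, (t <= diameter I + k)%N &
              gathered A (L k I) mu t).
Proof.
exists 6, (fun k I => projT1 (cid (instance_labels I))), count_algorithm => k I k1 d1.
have [size_lab gath] := projT2 (cid (instance_labels I)) k1 d1; split=> //.
set M := minn k (max_degree I) in size_lab.
have M_gt0 : (0 < M)%N by rewrite leq_min k1.
apply: (@le_trans _ _ (6 * (trunc_log 2 M).+1)%:R).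
  by rewrite ler_nat; apply/bigop.bigmax_leqP => v _.
rewrite natrM ler_wpM2l// -natr1 addrC lerD2l le_min.
by rewrite !trunc_log_log2// M_gt0 /= ?geq_minl ?geq_minr.
Qed.
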